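(* Let $I=(U,R)$ be an approximation space (a non-empty finite set $U$ with an equivalence relation $R$ on $U$), and let $(T,\Delta,\nabla)$ be its rough semiring. Then $RBHey(T)=(T,\Delta,\nabla,{}^{*},{}^{+},\rightarrow,\leftarrow,RS(\emptyset),RS(U))$ is a rough bi-Heyting algebra.
   Context: Setting. $U$ is a non-empty finite set, $R$ an equivalence relation on $U$, $[x]_R$ the class of $x$. For $X\subseteq U$ put $R_{-}(X)=\{x\in U: [x]_R\subseteq X\}$, $R^{-}(X)=\{x\in U: [x]_R\cap X\neq\emptyset\}$. The rough set of $X$ is $RS(X)=(R_{-}(X),R^{-}(X))$, and $T=\{RS(X): X\subseteq U\}$. $T$ is ordered componentwise: $RS(X)\le RS(Y)$ iff $R_{-}(X)\subseteq R_{-}(Y)$ and $R^{-}(X)\subseteq R^{-}(Y)$. Operations on subsets of $U$. Let $IW(X)$ be the number of equivalence classes contained in $X$. Praba join: if $IW(X\cup Y)=IW(X)+IW(Y)-IW(X\cap Y)$ then $X\Delta Y=X\cup Y$. If $IW(X\cup Y)>IW(X)+IW(Y)-IW(X\cap Y)$, one identifies an equivalence class newly formed by the union (contained in $X\cup Y$ but in neither $X$ nor $Y$), deletes from $Y$ its elements belonging to that class, calls the result $Y$ again, and repeats until equality holds; then $X\Delta Y$ is the union of $X$ and the final $Y$. Praba meet: $x$ is a pivot element of $X,Y$ if $[x]_R\not\subseteq X\cap Y$, $[x]_R\cap X\ne\emptyset$ and $[x]_R\cap Y\neq\emptyset$; the pivot set $P_{X\cap Y}$ consists of one representative pivot element for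 each such class; $X\nabla Y=\{x\in U:[x]_R\subseteq X\cap Y\}\cup P_{X\cap Y}$. Operations on $T$. $RS(X)\Delta RS(Y)=RS(X\Delta Y)$ and $RS(X)\nabla RS(Y)=RS(X\nabla Y)$; it is known that these are respectively the least upper bound and the greatest lower bound of $RS(X),RS(Y)$ in $T$, and that $(T,\Delta,\nabla)$ is a semiring, called the rough semiring. $RS(\emptyset)$ and $RS(U)$ are the least and greatest elements of $T$. Definitions. - Pseudocomplement: $RS(X)^{*}=\max\{RS(Y)\in T: RS(X)\nabla RS(Y)=RS(\emptyset)\}$. - Dual pseudocomplement: $RS(X)^{+}=\min\{RS(Y)\in T: RS(X)\Delta RS(Y)=RS(U)\}$. - Relative pseudocomplement of $RS(Y)$ with respect to $RS(Z)$: $RS(Y)\rightarrow RS(Z)=\max\{RS(W)\in T: RS(Y)\nabla RS(W)\le RS(Z)\}$. - Dual relative pseudocomplement of $RS(Y)$ with respect to $RS(Z)$: $RS(Y)\leftarrow RS(Z)=\min\{RS(V)\in T: RS(Z)\Delta RS(V)\ge RS(Y)\}$. Here max/min mean greatest/least element of the indicated set. - A rough Heyting algebra $(T,\Delta,\nabla,{}^{*},\rightarrow,RS(\emptyset),RS(U))$ is a rough semiring with least element $RS(\emptyset)$ in which the relative pseudocomplement is defined (exists) for every pair of elements of $T$; here $RS(X)^{*}=RS(X)\rightarrow RS(\emptyset)$. - A dual rough Heyting algebra $(T,\Delta,\nabla,{}^{+},\leftarrow,RS(\emptyset),RS(U))$ is a rough semiring with greatest element $RS(U)$ in which the dual relative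 pseudocomplement is defined (exists) for every pair of elements of $T$; here $RS(X)^{+}=RS(U)\leftarrow RS(X)$. - A rough bi-Heyting algebra $(T,\Delta,\nabla,{}^{*},{}^{+},\rightarrow,\leftarrow,RS(\emptyset),RS(U))$ is a rough semiring that is both a rough Heyting algebra and a dual rough Heyting algebra. *)

(* Defs.v *)
(* Mathematical Components. *)
From mathcomp Require Import all_boot.

Set Implicit Arguments.
Unset Strict Implicit.
Unset Printing Implicit Defensive.

Section ApproximationSpace.

Variables (U : finType) (R : rel U).
Implicit Types (x : U) (X Y Z C P : {set U}).

Definition eqclass x : {set U} := [set y | R x y].

Definition lower X : {set U} := [set x | eqclass x \subset X].

Definition upper X : {set U} := [set x | eqclass x :&: X != set0].

Definition rough_pair X : {set U} * {set U} := (lower X, upper X).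

Definition rough : Type := {p | p \in [set rough_pair X | X : {set U}]}.

Lemma rough_pair_in X : rough_pair X \in [set rough_pair Y | Y : {set U}].
Proof. exact: imset_f. Qed.

Definition RS X : rough := exist _ (rough_pair X) (rough_pair_in X).

Definition rle (a b : rough) : bool :=
  ((val a).1 \subset (val b).1) && ((val a).2 \subset (val b).2).

Definition IW X : nat :=
  #|[set C in equivalence_partition R [set: U] | C \subset X]|.

Definition new_class X Y C : bool :=
  [&& C \in equivalence_partition R [set: U], C \subset X :|: Y,
      ~~ (C \subset X) & ~~ (C \subset Y)].

(* The natural subtraction is exact, since IW (X :&: Y) <= IW X. *)
Definition join_done X Y : bool :=
  IW (X :|: Y) == IW X + IW Y - IW (X :&: Y).

Definition join_step X : rel {set U} := fun Y Y' =>
  (IW X + IW Y - IW (X :&: Y) < IW (X :|: Y)) &&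
  [exists C, new_class X Y C && (Y' == Y :\: C)].

(* The newly formed classes may be deleted in any order, so the Praba join is
   a relation: praba_join X Y Z holds when Z is a possible value of the join
   of X and Y. *)
Definition praba_join X Y Z : bool :=
  [exists Y', [&& connect (join_step X) Y Y', join_done X Y'
                & Z == X :|: Y']].

Definition pivots X Y : {set U} :=
  [set x | [&& ~~ (eqclass x \subset X :&: Y), eqclass x :&: X != set0
             & eqclass x :&: Y != set0]].

Definition pivot_set X Y P : bool :=
  is_transversal P (equivalence_partition R (pivots X Y)) (pivots X Y).

(* Likewise a relation, the pivot representatives being arbitrary. *)
Definition praba_meet X Y Z : bool :=
  [exists P, pivot_set X Y P &&
     (Z == [set x | eqclass x \subset X :&: Y] :|: P)].

(* The operation on rough sets sending (RS X, RS Y) to RS Z whenever op X Y Z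
   holds.  The choice of X, Y and Z is immaterial when [induced op] holds of
   it, and the default value is irrelevant when op is total. *)
Definition lift_op (op : {set U} -> {set U} -> pred {set U})
    (a b : rough) : rough :=
  odflt (RS set0)
    [pick c | [exists X, exists Y, exists Z,
                 [&& a == RS X, b == RS Y, op X Y Z & c == RS Z]]].

Definition induced (op : {set U} -> {set U} -> pred {set U})
    (f : rough -> rough -> rough) : Prop :=
  forall X Y, (exists Z, op X Y Z) /\
    (forall Z, op X Y Z -> f (RS X) (RS Y) = RS Z).

Definition rs_join : rough -> rough -> rough := lift_op praba_join.
Definition rs_meet : rough -> rough -> rough := lift_op praba_meet.

Definition is_greatest (S : pred rough) (m : rough) : bool :=
  S m && [forall b, S b ==> rle b m].

Definition is_least (S : pred rough) (m : rough) : bool :=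
  S m && [forall b, S b ==> rle m b].

(* The default values are only taken when the extremum does not exist. *)
Definition rs_max (S : pred rough) : rough :=
  odflt (RS set0) [pick m | is_greatest S m].
Definition rs_min (S : pred rough) : rough :=
  odflt (RS set0) [pick m | is_least S m].

Definition pc (a : rough) : rough :=
  rs_max [pred b | rs_meet a b == RS set0].
Definition dual_pc (a : rough) : rough :=
  rs_min [pred b | rs_join a b == RS [set: U]].
Definition rel_pc (a b : rough) : rough :=
  rs_max [pred w | rle (rs_meet a w) b].
Definition dual_rel_pc (a b : rough) : rough :=
  rs_min [pred v | rle a (rs_join b v)].

Record semiring (add mul : rough -> rough -> rough) (zero one : rough) : Prop
    := Semiring {
  semiring_addA : associative add;
  semiring_addC : commutative add;
  semiring_add0 : left_id zero add;
  semiring_mulA : associative mul;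
  semiring_mul1l : left_id one mul;
  semiring_mul1r : right_id one mul;
  semiring_mulDl : left_distributive mul add;
  semiring_mulDr : right_distributive mul add;
  semiring_mul0l : left_zero zero mul;
  semiring_mul0r : right_zero zero mul
}.

Record rough_semiring (join meet : rough -> rough -> rough) : Prop
    := RoughSemiring {
  rough_semiring_join : induced praba_join join;
  rough_semiring_meet : induced praba_meet meet;
  rough_semiring_axioms : semiring join meet (RS set0) (RS [set: U])
}.

Record rough_Heyting (join meet : rough -> rough -> rough)
    (star : rough -> rough) (imp : rough -> rough -> rough)
    (bot top : rough) : Prop := RoughHeyting {
  rough_Heyting_semiring : rough_semiring join meet;
  rough_Heyting_bot : is_least predT bot;
  rough_Heyting_top : is_greatest predT top;
  rough_Heyting_imp : forall a b,
    is_greatest [pred w | rle (meet a w) b] (imp a b);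
  rough_Heyting_star : forall a,
    is_greatest [pred b | meet a b == bot] (star a);
  rough_Heyting_starE : forall a, star a = imp a bot
}.

Record dual_rough_Heyting (join meet : rough -> rough -> rough)
    (plus : rough -> rough) (coimp : rough -> rough -> rough)
    (bot top : rough) : Prop := DualRoughHeyting {
  dual_rough_Heyting_semiring : rough_semiring join meet;
  dual_rough_Heyting_bot : is_least predT bot;
  dual_rough_Heyting_top : is_greatest predT top;
  dual_rough_Heyting_coimp : forall a b,
    is_least [pred v | rle a (join b v)] (coimp a b);
  dual_rough_Heyting_plus : forall a,
    is_least [pred b | join a b == top] (plus a);
  dual_rough_Heyting_plusE : forall a, plus a = coimp top a
}.

Definition rough_bi_Heyting (join meet : rough -> rough -> rough)
    (star plus : rough -> rough) (imp coimp : rough -> rough -> rough)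
    (bot top : rough) : Prop :=
  rough_Heyting join meet star imp bot top /\
  dual_rough_Heyting join meet plus coimp bot top.

End ApproximationSpace.

(* Main.v *)
(** Praba join and meet are computed componentwise on the pairs (lower, upper):
    they are the union and the intersection, whatever new classes are deleted
    and whatever pivots are chosen.  Hence T is a finite distributive lattice.
    In such a lattice {w | a /\ w <= b} is closed under joins and contains the
    bottom, so the join of all its elements is its greatest element, and
    dually. *)
Require Import Defs.
From mathcomp Require Import all_boot.

Set Implicit Arguments.
Unset Strict Implicit.
Unset Printing Implicit Defensive.

Section RoughSets.

Variables (U : finType) (R : rel U).
Implicit Types (x y : U) (X Y Z C P : {set U}) (a b c : rough R).
Implicit Types (S : pred (rough R)).

(** * Approximations of unions and of the extreme sets *)

Lemma upperU X Y : upper R (X :|: Y) = upper R X :|: upper R Y.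
Proof. by apply/setP=> x; rewrite !inE setIUr setU_eq0 negb_and. Qed.

Lemma lower0 : equivalence_rel R -> lower R set0 = set0.
Proof.
move=> eqR; apply/setP=> x; rewrite !inE; apply/negP=> /subsetP/(_ x).
by rewrite !inE (eqR x x x).1 => /(_ isT).
Qed.

Lemma upper0 : upper R set0 = set0.
Proof. by apply/setP=> x; rewrite !inE setI0 eqxx. Qed.

Lemma lowerT : lower R [set: U] = [set: U].
Proof. by apply/setP=> x; rewrite !inE subsetT. Qed.

Lemma upperT : equivalence_rel R -> upper R [set: U] = [set: U].
Proof.
move=> eqR; apply/setP=> x; rewrite !inE setIT.
by apply/set0Pn; exists x; rewrite inE (eqR x x x).1.
Qed.

(** * Counting classes and deleting new ones *)

Lemma classesP C :
  reflect (exists x, C = eqclass R x) (C \in equivalence_partition R [set: U]).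
Proof.
apply: (iffP imsetP) => [[x _ ->]|[x ->]]; exists x => //;
  by apply/setP=> y; rewrite !inE.
Qed.

(** Containment of classes commutes with intersection, so inclusion-exclusion counts the classes
    inside [X] or inside [Y]; what remains inside the union is exactly the new classes. The defect
    in the counting identity is thus their number. *)
Lemma IW_setU X Y :
  IW R (X :|: Y) =
    IW R X + IW R Y - IW R (X :&: Y) + #|[set C | new_class R X Y C]|.
Proof.
pose cl Z := [set C in equivalence_partition R [set: U] | C \subset Z].
have clI : cl (X :&: Y) = cl X :&: cl Y.
  by apply/setP=> C; rewrite !inE subsetI andbACA andbb.
rewrite /IW -/(cl _) -/(cl X) -/(cl Y) -/(cl (X :&: Y)) clI -cardsU.
have sU : cl X :|: cl Y \subset cl (X :|: Y).
  apply/subsetP=> C; rewrite !inE => /orP[] /andP[-> sC] /=.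
    exact: subset_trans sC (subsetUl _ _).
  exact: subset_trans sC (subsetUr _ _).
rewrite -(cardsID (cl X :|: cl Y) (cl (X :|: Y))) (setIidPr sU).
congr (_ + _); apply: eq_card => C; rewrite !inE /new_class.
by case: (C \in _) => //=; rewrite negb_or andbC.
Qed.

Lemma join_doneE X Y : join_done R X Y = [forall C, ~~ new_class R X Y C].
Proof.
rewrite /join_done IW_setU -{2}[_ - _]addn0 eqn_add2l cards_eq0.
apply/eqP/forallP=> [n0 C|n0]; last by apply/setP=> C; rewrite !inE (negbTE (n0 C)).
by move/setP: n0 => /(_ C); rewrite !inE => ->.
Qed.

(** The strict inequality guarding a step already follows from the existence of a new class. *)
Lemma join_stepP X Y Y' :
  reflect (exists2 C, new_class R X Y C & Y' = Y :\: C) (join_step R X Y Y').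
Proof.
apply: (iffP andP) => [[_ /existsP[C /andP[newC /eqP ->]]]|[C newC ->]].
  by exists C.
split; last by apply/existsP; exists C; rewrite newC eqxx.
rewrite IW_setU -[X in X < _]addn0 ltn_add2l card_gt0.
by apply/set0Pn; exists C; rewrite inE.
Qed.

Hypothesis eqR : equivalence_rel R.

Lemma equiv_refl : reflexive R.
Proof. by move=> x; rewrite (eqR x x x).1. Qed.

Lemma eqclass_refl x : x \in eqclass R x.
Proof. by rewrite inE equiv_refl. Qed.

Lemma eqclass_eq x y : R x y -> eqclass R x = eqclass R y.
Proof. by move=> Rxy; apply/setP=> z; rewrite !inE; apply: (eqR x y z).2. Qed.

(** A new class is not contained in [Y], and every class that is contained in [Y] is disjoint from
    it, hence survives the deletion. *)
Lemma new_class_lower X Y C :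
  new_class R X Y C -> lower R (Y :\: C) = lower R Y.
Proof.
case/and4P=> /classesP[x ->] _ _ nsY; apply/setP=> y; rewrite !inE subsetD.
case sY: (_ \subset Y) => //=; rewrite -setI_eq0; apply/eqP/setP=> z; rewrite !inE.
apply: contraNF nsY => /andP[Ryz Rxz].
by rewrite (eqclass_eq Rxz) -(eqclass_eq Ryz).
Qed.

(** Only [C] itself can drop out of the upper approximation of [Y]. Since [C] lies in the union but
    not in [Y], it meets [X], so [upper R X] still covers it. *)
Lemma new_class_upper X Y C : new_class R X Y C ->
  upper R X :|: upper R (Y :\: C) = upper R X :|: upper R Y.
Proof.
case/and4P=> /classesP[x ->] sXY _ /subsetPn[y yC nyY]; apply/setP=> z; rewrite !inE.
case: (boolP (R x z)) => [Rxz|nRxz].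
  suff -> : eqclass R z :&: X != set0 by [].
  apply/set0Pn; exists y; rewrite inE -(eqclass_eq Rxz) yC /=.
  by move/subsetP/(_ _ yC): sXY; rewrite inE (negbTE nyY) orbF.
congr (_ || (_ != _)); apply/setP=> t; rewrite !inE.
case Rzt: (R z t) => //=; case Rxt: (R x t) => //=.
have := eqclass_refl z.
by rewrite (eqclass_eq Rzt) -(eqclass_eq Rxt) inE (negbTE nRxz).
Qed.

Lemma connect_join_step X Y Y' : connect (join_step R X) Y Y' ->
  lower R Y' = lower R Y /\
  upper R X :|: upper R Y' = upper R X :|: upper R Y.
Proof.
case/connectP=> p + ->; elim: p Y => //= Y1 p IHp Y /andP[/join_stepP[C newC ->]].
by move/IHp=> [-> ->]; rewrite (new_class_lower newC) (new_class_upper newC).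
Qed.

Lemma join_done_lower X Y :
  join_done R X Y -> lower R (X :|: Y) = lower R X :|: lower R Y.
Proof.
rewrite join_doneE => /forallP done; apply/setP=> x; rewrite !inE.
apply/idP/orP=> [sXY|[] sC]; last 2 first.
- exact: subset_trans sC (subsetUl _ _).
- exact: subset_trans sC (subsetUr _ _).
move: (done (eqclass R x)); rewrite /new_class sXY -negb_or.
have -> : eqclass R x \in equivalence_partition R [set: U].
  by apply/classesP; exists x.
by rewrite negbK => /orP.
Qed.

Lemma praba_join_pair X Y Z : praba_join R X Y Z ->
  rough_pair R Z = (lower R X :|: lower R Y, upper R X :|: upper R Y).
Proof.
case/existsP=> Y' /and3P[/connect_join_step[lowY upY] doneY /eqP->].
by rewrite /rough_pair join_done_lower // upperU lowY upY.
Qed.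

(** Deletion terminates: a reachable [Y'] of least cardinality admits no new class, because deleting
    one would shrink it. *)
Lemma praba_join_total X Y : exists Z, praba_join R X Y Z.
Proof.
have [Y' cY minY] :=
  arg_minnP (fun Y' => #|pred_of_set Y'|) (connect0 (join_step R X) Y).
exists (X :|: Y'); apply/existsP; exists Y'; rewrite cY eqxx andbT /=.
rewrite join_doneE; apply/forallP=> C; apply/negP=> newC.
have step : join_step R X Y' (Y' :\: C) by apply/join_stepP; exists C.
have := minY _ (connect_trans cY (connect1 step)); rewrite leqNgt => /negP[].
(* The deletion is strict: a point of [C] outside [X] must belong to [Y']. *)
apply: proper_card; case/and4P: newC => _ sXY /subsetPn[y yC nyX] _.
apply/properP; split; first exact: subsetDl.
exists y; last by rewrite inE yC.
by move/subsetP/(_ _ yC): sXY; rewrite inE (negbTE nyX).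
Qed.

(** * The Praba meet *)

Lemma lowerI X Y : lower R (X :&: Y) = lower R X :&: lower R Y.
Proof. by apply/setP=> x; rewrite !inE subsetI. Qed.

Lemma mem_lower_eq x y X : R x y -> (x \in lower R X) = (y \in lower R X).
Proof. by move=> Rxy; rewrite !inE (eqclass_eq Rxy). Qed.

Lemma mem_pivots_eq x y X Y :
  R x y -> (x \in pivots R X Y) = (y \in pivots R X Y).
Proof. by move=> Rxy; rewrite !inE (eqclass_eq Rxy). Qed.

(** The pivots form a union of classes, so the block of [x] in their partition is its whole
    class. *)
Lemma card_pivot_class X Y P x :
  pivot_set R X Y P -> x \in pivots R X Y -> #|P :&: eqclass R x| = 1.
Proof.
case/and3P=> _ _ /forall_inP trP xpiv.
apply/eqP/trP; apply/imsetP; exists x => //.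
apply/setP=> y; rewrite [LHS]inE [RHS]inE andbC.
by case Rxy: (R x y) => //=; rewrite -(mem_pivots_eq X Y Rxy) xpiv.
Qed.

(** A class meeting both [X] and [Y] either lies in [X :&: Y] or consists of pivots, and then it has
    a representative in [P]. *)
Lemma pivot_set_upper X Y P : pivot_set R X Y P ->
  upper R (lower R (X :&: Y) :|: P) = upper R X :&: upper R Y.
Proof.
move=> pP; have sP : P \subset pivots R X Y by case/and3P: pP.
apply/setP=> x; rewrite in_setI; apply/idP/andP.
  rewrite inE => /set0Pn[y]; rewrite inE [y \in eqclass _ _]inE => /andP[Rxy].
  case/setUP=> [|/(subsetP sP)].
    rewrite -(mem_lower_eq _ Rxy) inE => /subsetP/(_ _ (eqclass_refl x)).
    case/setIP=> xX xY; rewrite !inE.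
    by split; apply/set0Pn; exists x; rewrite inE eqclass_refl.
  by rewrite -(mem_pivots_eq _ _ Rxy) !inE => /and3P[].
rewrite !inE => -[xX xY]; apply/set0Pn.
case: (boolP (x \in lower R (X :&: Y))) => [xl|nxl].
  by exists x; rewrite inE eqclass_refl inE xl.
have xpiv : x \in pivots R X Y by rewrite inE in nxl; rewrite inE nxl xX.
have : 0 < #|P :&: eqclass R x| by rewrite (card_pivot_class pP xpiv).
by case/card_gt0P=> y /setIP[yP yx]; exists y; rewrite inE yx inE yP orbT.
Qed.

(* A pivot class is not a singleton, so its single representative does not put
   it in the lower approximation. *)
Lemma pivot_set_lower X Y P : pivot_set R X Y P ->
  lower R (lower R (X :&: Y) :|: P) = lower R X :&: lower R Y.
Proof.
move=> pP; have sP : P \subset pivots R X Y by case/and3P: pP.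
rewrite -lowerI; apply/setP=> x; rewrite [LHS]inE; apply/idP/idP=> [sx|xl]; last first.
  by apply/subsetP=> y; rewrite inE => Rxy; rewrite inE -(mem_lower_eq _ Rxy) xl.
apply: contraT => nxl.
(* The lower approximation is a union of classes, so the class of a point outside it avoids it
   entirely and must be covered by [P]. *)
have sxP : eqclass R x \subset P.
  apply/subsetP=> y yx; have := subsetP sx y yx; rewrite inE in yx.
  by rewrite inE -(mem_lower_eq _ yx) (negbTE nxl).
have xpiv := subsetP sP _ (subsetP sxP _ (eqclass_refl x)).
have := card_pivot_class pP xpiv; rewrite (setIidPr sxP) => /eqP/cards1P[z xz].
have {z xz} x1 : eqclass R x = [set x].
  by have := eqclass_refl x; rewrite xz inE => /eqP ->.
move: xpiv; rewrite !inE x1 => /and3P[/negP nsub /set0Pn[y] + /set0Pn[z]].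
case/setIP=> /set1P-> xX /setIP[/set1P-> xY]; case: nsub.
by rewrite sub1set inE xX.
Qed.

Lemma praba_meet_pair X Y Z : praba_meet R X Y Z ->
  rough_pair R Z = (lower R X :&: lower R Y, upper R X :&: upper R Y).
Proof.
case/existsP=> P /andP[pP /eqP->].
by rewrite /rough_pair (pivot_set_lower pP) (pivot_set_upper pP).
Qed.

Lemma praba_meet_total X Y : exists Z, praba_meet R X Y Z.
Proof.
pose P := transversal (equivalence_partition R (pivots R X Y)) (pivots R X Y).
exists (lower R (X :&: Y) :|: P); apply/existsP; exists P; rewrite eqxx andbT.
by apply/transversalP/equivalence_partitionP => x y z _ _ _; apply: eqR.
Qed.

(** * The induced operations on rough sets and the semiring *)

Lemma RS_surj a : exists X, a = RS R X.
Proof. by case: a => p pT; have /imsetP[X _ defp] := pT; exists X; apply: val_inj. Qed.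

Definition approx a : {set U} * {set U} := val a.

Lemma approx_inj : injective approx.
Proof. exact: val_inj. Qed.

Lemma rleE a b : rle a b = ((approx a).1 \subset (approx b).1)
                           && ((approx a).2 \subset (approx b).2).
Proof. by []. Qed.

(* The operations are kept abstract in this section: comparing two different
   instances of [rs_join] up to conversion evaluates [pick], which diverges. *)
Section ComponentwiseOperations.

Variables (join meet : rough R -> rough R -> rough R) (zero one : rough R).
Hypothesis approx_join : forall a b, approx (join a b) =
  ((approx a).1 :|: (approx b).1, (approx a).2 :|: (approx b).2).
Hypothesis approx_meet : forall a b, approx (meet a b) =
  ((approx a).1 :&: (approx b).1, (approx a).2 :&: (approx b).2).
Hypothesis approx_zero : approx zero = (set0, set0).
Hypothesis approx_one : approx one = ([set: U], [set: U]).

Lemma componentwise_semiring : semiring join meet zero one.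
Proof.
split=> [a b c|a b|a|a b c|a|a|a b c|a b c|a|a]; apply: approx_inj;
  rewrite !(approx_join, approx_meet, approx_zero, approx_one) /=.
- by rewrite !setUA.
- by rewrite setUC [X in (_, X)]setUC.
- by rewrite !set0U -surjective_pairing.
- by rewrite !setIA.
- by rewrite !setTI -surjective_pairing.
- by rewrite !setIT -surjective_pairing.
- by rewrite !setIUl.
- by rewrite !setIUr.
- by rewrite !set0I.
- by rewrite !setI0.
Qed.

(** Distributivity combined with the universal property of the join; this closes the set defining a
    relative pseudocomplement under joins. *)
Lemma componentwise_rle_meet_join a b c d :
  rle (meet a (join b c)) d = rle (meet a b) d && rle (meet a c) d.
Proof.
by rewrite !rleE !(approx_join, approx_meet) /= !setIUr !subUset andbACA.
Qed.

Lemma componentwise_rle_join_meet a b c d :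
  rle d (join a (meet b c)) = rle d (join a b) && rle d (join a c).
Proof.
by rewrite !rleE !(approx_join, approx_meet) /= !setUIr !subsetI andbACA.
Qed.

End ComponentwiseOperations.

(** Whichever representatives [pick] finds, the resulting pair depends only on the pairs of [a] and
    [b], so the choice is immaterial. *)
Lemma approx_lift_op (op : {set U} -> {set U} -> pred {set U}) h a b :
    (forall X Y, exists Z, op X Y Z) ->
    (forall X Y Z, op X Y Z ->
       rough_pair R Z = h (rough_pair R X) (rough_pair R Y)) ->
  approx (lift_op op a b) = h (approx a) (approx b).
Proof.
move=> op_total op_pair; rewrite /lift_op; case: pickP => [c|none] /=.
  case/existsP=> X /existsP[Y /existsP[Z /and4P[/eqP-> /eqP-> opZ /eqP->]]].
  exact: op_pair.
(* Totality of [op] supplies a candidate, so the default value never occurs. *)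
have [X aX] := RS_surj a; have [Y bY] := RS_surj b.
have [Z opZ] := op_total X Y.
have /existsP[] := none (RS R Z).
by exists X; apply/existsP; exists Y; apply/existsP; exists Z; rewrite aX bY opZ !eqxx.
Qed.

Lemma approx_join a b :
  approx (rs_join a b) = ((approx a).1 :|: (approx b).1, (approx a).2 :|: (approx b).2).
Proof.
exact: (@approx_lift_op _ (fun p q => (p.1 :|: q.1, p.2 :|: q.2)) a b
  praba_join_total praba_join_pair).
Qed.

Lemma approx_meet a b :
  approx (rs_meet a b) = ((approx a).1 :&: (approx b).1, (approx a).2 :&: (approx b).2).
Proof.
exact: (@approx_lift_op _ (fun p q => (p.1 :&: q.1, p.2 :&: q.2)) a b
  praba_meet_total praba_meet_pair).
Qed.

Lemma approx_RS0 : approx (RS R set0) = (set0, set0).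
Proof. by rewrite /approx /= /rough_pair lower0 // upper0. Qed.

Lemma approx_RST : approx (RS R [set: U]) = ([set: U], [set: U]).
Proof. by rewrite /approx /= /rough_pair lowerT upperT. Qed.

Lemma rough_semiring_join_meet : rough_semiring (@rs_join U R) (@rs_meet U R).
Proof.
split.
- move=> X Y; split=> [|Z /praba_join_pair defZ]; first exact: praba_join_total.
  by apply: approx_inj; rewrite approx_join /approx /= defZ.
- move=> X Y; split=> [|Z /praba_meet_pair defZ]; first exact: praba_meet_total.
  by apply: approx_inj; rewrite approx_meet /approx /= defZ.
- exact: (componentwise_semiring approx_join approx_meet approx_RS0 approx_RST).
Qed.

(** * The order on rough sets and the existence of extrema *)

Lemma rle_trans : transitive (@rle U R).
Proof.
move=> b a c /andP[ab1 ab2] /andP[bc1 bc2].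
by rewrite rleE (subset_trans ab1) // (subset_trans ab2).
Qed.

Lemma rle0x a : rle (RS R set0) a.
Proof. by rewrite rleE approx_RS0 !sub0set. Qed.

Lemma rlex1 a : rle a (RS R [set: U]).
Proof. by rewrite rleE approx_RST !subsetT. Qed.

Lemma rlex0 a : rle a (RS R set0) = (a == RS R set0).
Proof.
by rewrite -(inj_eq approx_inj) rleE approx_RS0 !subset0 -xpair_eqE -surjective_pairing.
Qed.

Lemma rle1x a : rle (RS R [set: U]) a = (a == RS R [set: U]).
Proof.
by rewrite -(inj_eq approx_inj) rleE approx_RST !subTset -xpair_eqE -surjective_pairing.
Qed.

Lemma rle_joinl a b : rle a (rs_join a b).
Proof. by rewrite rleE approx_join !subsetUl. Qed.

Lemma rle_joinr a b : rle b (rs_join a b).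
Proof. by rewrite rleE approx_join !subsetUr. Qed.

Lemma rle_meetl a b : rle (rs_meet a b) a.
Proof. by rewrite rleE approx_meet !subsetIl. Qed.

Lemma rle_meetr a b : rle (rs_meet a b) b.
Proof. by rewrite rleE approx_meet !subsetIr. Qed.

Lemma is_greatest_rs_max S :
    S (RS R set0) -> (forall a b, S a -> S b -> S (rs_join a b)) ->
  is_greatest S (rs_max S).
Proof.
move=> S0 Sjoin.
(* Stated for an arbitrary list to allow induction; [m] is the join of the members of [s] satisfying
   [S], starting from the bottom. *)
have maxs (s : seq (rough R)) :
    exists2 m, S m & forall b, b \in s -> S b -> rle b m.
  elim: s => [|a s [m Sm ms]]; first by exists (RS R set0).
  case Sa: (S a); last first.
    by exists m => // b; rewrite inE => /predU1P[->|/ms//]; rewrite Sa.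
  exists (rs_join a m) => [|b]; first exact: Sjoin.
  rewrite inE => /predU1P[-> _|bs Sb]; first exact: rle_joinl.
  exact: rle_trans (ms b bs Sb) (rle_joinr a m).
have [m Sm mmax] := maxs (enum {: rough R}).
(* The bound [m] is itself a greatest element, which excludes the default of [rs_max]. *)
rewrite /rs_max; case: pickP => //= /(_ m)/negP[]; rewrite /is_greatest Sm.
by apply/forall_inP=> b; apply: mmax; rewrite mem_enum.
Qed.

Lemma is_least_rs_min S :
    S (RS R [set: U]) -> (forall a b, S a -> S b -> S (rs_meet a b)) ->
  is_least S (rs_min S).
Proof.
move=> S1 Smeet.
have mins (s : seq (rough R)) :
    exists2 m, S m & forall b, b \in s -> S b -> rle m b.
  elim: s => [|a s [m Sm ms]]; first by exists (RS R [set: U]).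
  case Sa: (S a); last first.
    by exists m => // b; rewrite inE => /predU1P[->|/ms//]; rewrite Sa.
  exists (rs_meet a m) => [|b]; first exact: Smeet.
  rewrite inE => /predU1P[-> _|bs Sb]; first exact: rle_meetl.
  exact: rle_trans (rle_meetr a m) (ms b bs Sb).
have [m Sm mmin] := mins (enum {: rough R}).
rewrite /rs_min; case: pickP => //= /(_ m)/negP[]; rewrite /is_least Sm.
by apply/forall_inP=> b; apply: mmin; rewrite mem_enum.
Qed.

(** Lets extrema be compared under pointwise equality of predicates, without functional
    extensionality. *)
Lemma eq_is_greatest S1 S2 : S1 =1 S2 -> is_greatest S1 =1 is_greatest S2.
Proof.
by move=> eqS a; rewrite /is_greatest eqS; under eq_forallb do rewrite eqS.
Qed.

Lemma eq_is_least S1 S2 : S1 =1 S2 -> is_least S1 =1 is_least S2.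
Proof.
by move=> eqS a; rewrite /is_least eqS; under eq_forallb do rewrite eqS.
Qed.

(** * Pseudocomplements and their duals *)

Lemma rel_pcP a b : is_greatest [pred w | rle (rs_meet a w) b] (rel_pc a b).
Proof.
apply: is_greatest_rs_max => [|v w av aw] /=.
  exact: rle_trans (rle_meetr _ _) (rle0x _).
rewrite (componentwise_rle_meet_join approx_join approx_meet).
exact/andP/(conj av aw).
Qed.

Lemma dual_rel_pcP a b :
  is_least [pred v | rle a (rs_join b v)] (dual_rel_pc a b).
Proof.
apply: is_least_rs_min => [|v w av aw] /=.
  exact: rle_trans (rlex1 a) (rle_joinr _ _).
rewrite (componentwise_rle_join_meet approx_join approx_meet).
exact/andP/(conj av aw).
Qed.

(** Only the bottom lies below the bottom, so both sides are maxima over the same elements and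
    [pick] selects the same one. *)
Lemma pcE a : pc a = rel_pc a (RS R set0).
Proof.
by congr odflt; apply/eq_pick/eq_is_greatest => b /=; rewrite rlex0.
Qed.

Lemma dual_pcE a : dual_pc a = dual_rel_pc (RS R [set: U]) a.
Proof.
by congr odflt; apply/eq_pick/eq_is_least => b /=; rewrite rle1x.
Qed.

Lemma pcP a : is_greatest [pred b | rs_meet a b == RS R set0] (pc a).
Proof.
rewrite pcE -(eq_is_greatest (S1 := [pred b | rle (rs_meet a b) (RS R set0)])).
  exact: rel_pcP.
by move=> b /=; rewrite rlex0.
Qed.

Lemma dual_pcP a : is_least [pred b | rs_join a b == RS R [set: U]] (dual_pc a).
Proof.
rewrite dual_pcE -(eq_is_least (S1 := [pred b | rle (RS R [set: U]) (rs_join a b)])).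
  exact: dual_rel_pcP.
by move=> b /=; rewrite rle1x.
Qed.

End RoughSets.

Theorem theorem9 (U : finType) (R : rel U)
    (U_nonempty : 0 < #|U|) (R_equiv : equivalence_rel R) :
  rough_bi_Heyting (@rs_join U R) (@rs_meet U R) (@pc U R) (@dual_pc U R)
    (@rel_pc U R) (@dual_rel_pc U R) (RS R set0) (RS R [set: U]).
Proof.
have bot : is_least predT (RS R set0) by apply/forallP=> b; exact: rle0x.
have top : is_greatest predT (RS R [set: U]) by apply/forallP=> b; exact: rlex1.
split; split.
- exact: rough_semiring_join_meet.
- exact: bot.
- exact: top.
- exact: rel_pcP.
- exact: pcP.
- exact: pcE.
- exact: rough_semiring_join_meet.
- exact: bot.
- exact: top.
- exact: dual_rel_pcP.
- exact: dual_pcP.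
- exact: dual_pcE.
Qed.
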